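(* Let $Q(\cdot)$ be a generalized Moufang loop with respect to a mapping $\alpha$ of $Q$ onto itself, with universal $\alpha$-elasticity, such that $(y^{\alpha}\cdot b)\cdot b^{\alpha}=(y\cdot z)^{\alpha}\cdot z$ for all $y,z,b\in Q$, and such that $\alpha$ is a homomorphic self map (i.e. $(x\cdot y)^{\alpha}=x^{\alpha}\cdot y^{\alpha}$ for all $x,y\in Q$). Then $Q(\cdot)$ is a generalized Moufang loop if and only if it is a middle generalized Bol loop.
   Context: A loop $(Q,\cdot)$ is a quasigroup with a two-sided identity element; $b\backslash a$ denotes the unique $u$ with $b\cdot u=a$, and $a/b$ the unique $v$ with $v\cdot b=a$. For a mapping $\alpha$ of $Q$ onto itself, $y^{\alpha}$ denotes the image of $y$ under $\alpha$. A loop $Q$ is a generalized Moufang loop (with respect to $\alpha$) if $((x\cdot y)\cdot z)\cdot y^{\alpha}=x\cdot(y\cdot(z\cdot y^{\alpha}))$ for all $x,y,z\in Q$. A loop $Q$ is a middle generalized Bol loop (with respect to $\alpha$) if $(x/y)\cdot(z^{\alpha}\backslash x^{\alpha})=x\cdot\big((z^{\alpha}\cdot y)\backslash x^{\alpha}\big)$ for all $x,y,z\in Q$. The $\alpha$-elasticity identity is $(y\cdot z)\cdot y^{\alpha}=y\cdot(z\cdot y^{\alpha})$ for all $y,z\in Q$. The principal isotopes of $(Q,\cdot)$ are the loops $(Q,\circ)$ with $x\circ y=(x/a)\cdot(b\backslash y)$, for $a,b\in Q$. $Q$ has universal $\alpha$-elasticity if the $\alpha$-elasticity identity (with the same map $\alpha$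 on the set $Q$) holds in $(Q,\cdot)$ and in each of its principal isotopes. *)

(* Defs.v *)
(* In a quasigroup both divisions are total and determined by the product:
   [ldiv b a] is the unique u with b * u = a, and [rdiv a b] is the unique v
   with v * b = a, so carrying them as fields adds no structure. *)
Record loop : Type := Loop {
  carrier :> Type;
  mul : carrier -> carrier -> carrier;
  ldiv : carrier -> carrier -> carrier;
  rdiv : carrier -> carrier -> carrier;
  one : carrier;
  ldiv_spec : forall a b u, mul b u = a <-> u = ldiv b a;
  rdiv_spec : forall a b v, mul v b = a <-> v = rdiv a b;
  mul1l : forall x, mul one x = x;
  mul1r : forall x, mul x one = x
}.

Arguments mul {_} _ _.
Arguments ldiv {_} _ _.
Arguments rdiv {_} _ _.
Arguments one {_}.

Declare Scope loop_scope.
Delimit Scope loop_scope with L.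
Bind Scope loop_scope with carrier.
Notation "x * y" := (mul x y) : loop_scope.
Notation "b \ a" := (ldiv b a) (at level 40, left associativity) : loop_scope.
Notation "a / b" := (rdiv a b) : loop_scope.
Local Open Scope loop_scope.

Lemma mulKdiv (Q : loop) (b a : Q) : b * (b \ a) = a.
Proof. now apply ldiv_spec. Qed.

Lemma divmulK (Q : loop) (a b : Q) : (a / b) * b = a.
Proof. now apply rdiv_spec. Qed.

Lemma ldivK (Q : loop) (b u : Q) : b \ (b * u) = u.
Proof. symmetry; now apply ldiv_spec. Qed.

Lemma rdivK (Q : loop) (v b : Q) : (v * b) / b = v.
Proof. symmetry; now apply rdiv_spec. Qed.

Definition iso_mul (Q : loop) (a b x y : Q) : Q := (x / a) * (b \ y).
Definition iso_ldiv (Q : loop) (a b x y : Q) : Q := b * ((x / a) \ y).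
Definition iso_rdiv (Q : loop) (a b x y : Q) : Q := (x / (b \ y)) * a.

Lemma iso_ldiv_spec (Q : loop) (a b x y u : Q) :
  iso_mul Q a b y u = x <-> u = iso_ldiv Q a b y x.
Proof.
unfold iso_mul, iso_ldiv; split.
- intros <-; now rewrite ldivK, mulKdiv.
- intros ->; now rewrite ldivK, mulKdiv.
Qed.

Lemma iso_rdiv_spec (Q : loop) (a b x y v : Q) :
  iso_mul Q a b v y = x <-> v = iso_rdiv Q a b x y.
Proof.
unfold iso_mul, iso_rdiv; split.
- intros <-; now rewrite rdivK, divmulK.
- intros ->; now rewrite rdivK, divmulK.
Qed.

Lemma iso_mul1l (Q : loop) (a b x : Q) : iso_mul Q a b (b * a) x = x.
Proof. unfold iso_mul; now rewrite rdivK, mulKdiv. Qed.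

Lemma iso_mul1r (Q : loop) (a b x : Q) : iso_mul Q a b x (b * a) = x.
Proof. unfold iso_mul; now rewrite ldivK, divmulK. Qed.

Definition principal_isotope (Q : loop) (a b : Q) : loop :=
  Loop Q (iso_mul Q a b) (iso_ldiv Q a b) (iso_rdiv Q a b) (b * a)
    (fun x y u => iso_ldiv_spec Q a b x y u)
    (fun x y v => iso_rdiv_spec Q a b x y v)
    (iso_mul1l Q a b) (iso_mul1r Q a b).

Definition generalized_moufang (Q : loop) (alpha : Q -> Q) : Prop :=
  forall x y z : Q, ((x * y) * z) * alpha y = x * (y * (z * alpha y)).

Definition middle_generalized_bol (Q : loop) (alpha : Q -> Q) : Prop :=
  forall x y z : Q,
    (x / y) * (alpha z \ alpha x) = x * ((alpha z * y) \ alpha x).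

Definition elastic (Q : loop) (alpha : Q -> Q) : Prop :=
  forall y z : Q, (y * z) * alpha y = y * (z * alpha y).

Definition universally_elastic (Q : loop) (alpha : Q -> Q) : Prop :=
  elastic Q alpha /\ forall a b : Q, elastic (principal_isotope Q a b) alpha.

(* Main.v *)
Require Import Defs.
From Stdlib Require Import FinFun.
Local Open Scope loop_scope.

(** Only the passage to the middle generalized Bol identity needs an argument.
The hypotheses force [alpha] to be inversion.  As a homomorphism it fixes
[one], so [(alpha y * b) * alpha b = alpha (y * z) * z] with [y = b = one]
reads [alpha z * z = one]; with [z = one] instead, [alpha] being onto, it is the
right inverse property [(x * b) * alpha b = x].  The Moufang identity then
gives the left inverse property ([left_inverse_property]).

In a loop with both inverse properties inversion reverses products; since here
it also preserves them, the loop is commutative ([commutative_of_inversion]).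
Commutativity collapses [y * (z * alpha y)] to [z], so the Moufang identity
becomes [(x * y) * z = (x * z) * y], which is associativity
([associative_of_moufang]).  Thus [Q] is an abelian group with
[alpha x = x^-1], where both sides of the middle Bol identity equal
[y^-1 * z] ([middle_bol_of_abelian_group]). *)

Lemma mul_cancel_l (Q : loop) (b u v : Q) : b * u = b * v -> u = v.
Proof.
  intro E.
  now rewrite <- (ldivK Q b u), E, ldivK.
Qed.

Lemma hom_one (Q : loop) (alpha : Q -> Q)
  (alpha_hom : forall x y : Q, alpha (x * y) = alpha x * alpha y) :
  alpha one = one.
Proof.
  apply (mul_cancel_l Q (alpha one)).
  now rewrite <- alpha_hom, !mul1r.
Qed.

(** Substituting [z := w * y], which the right inverse property makes
invertible in [w], and [x := alpha y] turns the Moufang identity into this. *)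
Lemma left_inverse_property (Q : loop) (alpha : Q -> Q)
  (Q_moufang : generalized_moufang Q alpha)
  (invl : forall x : Q, alpha x * x = one)
  (rip : forall x y : Q, (x * y) * alpha y = x) :
  forall y w : Q, alpha y * (y * w) = w.
Proof.
  intros y w.
  assert (E := Q_moufang (alpha y) y (w * y)).
  now rewrite invl, mul1l, !rip in E.
Qed.

Lemma inversion_involutive (Q : loop) (alpha : Q -> Q)
  (invl : forall x : Q, alpha x * x = one)
  (rip : forall x y : Q, (x * y) * alpha y = x) :
  forall x : Q, alpha (alpha x) = x.
Proof.
  intro x.
  apply (mul_cancel_l Q (alpha x)).
  rewrite invl.
  now rewrite <- (mul1l Q (alpha x)) at 1; rewrite rip.
Qed.

(** The inverse properties give [alpha (x * y) = alpha y * alpha x], while the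
homomorphism property gives the other order. *)
Lemma commutative_of_inversion (Q : loop) (alpha : Q -> Q)
  (alpha_hom : forall x y : Q, alpha (x * y) = alpha x * alpha y)
  (alphaK : forall x : Q, alpha (alpha x) = x)
  (lip : forall x y : Q, alpha x * (x * y) = y)
  (rip : forall x y : Q, (x * y) * alpha y = x) :
  forall x y : Q, x * y = y * x.
Proof.
  assert (anti : forall x y : Q, alpha (x * y) = alpha y * alpha x).
  { intros x y.
    assert (E := lip (x * y) (alpha y)).
    rewrite rip in E.
    now rewrite <- E, rip. }
  intros x y.
  rewrite <- (alphaK x), <- (alphaK y).
  now rewrite <- alpha_hom, anti.
Qed.

(** By commutativity and the inverse property [y * (z * alpha y) = z], so the
Moufang identity says that right translations commute; together with
commutativity of the product this is associativity. *)
Lemma associative_of_moufang (Q : loop) (alpha : Q -> Q)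
  (Q_moufang : generalized_moufang Q alpha)
  (alphaK : forall x : Q, alpha (alpha x) = x)
  (rip : forall x y : Q, (x * y) * alpha y = x)
  (comm : forall x y : Q, x * y = y * x) :
  forall x y z : Q, (x * y) * z = x * (y * z).
Proof.
  assert (swap : forall x y z : Q, (x * y) * z = (x * z) * y).
  { intros x y z.
    assert (cancel : y * (z * alpha y) = z).
    { rewrite comm.
      rewrite <- (alphaK y) at 2.
      apply rip. }
    assert (E := Q_moufang x y z).
    rewrite cancel in E.
    rewrite <- E.
    rewrite <- (alphaK y) at 4.
    now rewrite rip. }
  intros x y z.
  now rewrite (comm x y), swap, comm.
Qed.

Lemma middle_bol_of_abelian_group (Q : loop) (alpha : Q -> Q)
  (alpha_hom : forall x y : Q, alpha (x * y) = alpha x * alpha y)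
  (invl : forall x : Q, alpha x * x = one)
  (alphaK : forall x : Q, alpha (alpha x) = x)
  (comm : forall x y : Q, x * y = y * x)
  (assoc : forall x y z : Q, (x * y) * z = x * (y * z)) :
  middle_generalized_bol Q alpha.
Proof.
  assert (ldivE : forall x y : Q, x \ y = alpha x * y).
  { intros x y; symmetry; apply -> ldiv_spec.
    now rewrite <- assoc, (comm x), invl, mul1l. }
  assert (rdivE : forall x y : Q, x / y = x * alpha y).
  { intros x y; symmetry; apply -> rdiv_spec.
    now rewrite assoc, invl, mul1r. }
  intros x y z.
  rewrite !ldivE, rdivE, alpha_hom, alphaK.
  now rewrite (comm z (alpha y)), !assoc.
Qed.

Theorem theorem3p3 (Q : loop) (alpha : Q -> Q)
  (alpha_onto : Surjective alpha)
  (Q_moufang : generalized_moufang Q alpha)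
  (Q_elastic : universally_elastic Q alpha)
  (Q_id : forall y z b : Q,
     (alpha y * b) * alpha b = alpha (y * z) * z)
  (alpha_hom : forall x y : Q, alpha (x * y) = alpha x * alpha y) :
  generalized_moufang Q alpha <-> middle_generalized_bol Q alpha.
Proof.
  split; [intros _ | intros _; exact Q_moufang].
  assert (alpha1 := hom_one Q alpha alpha_hom).
  assert (invl : forall x : Q, alpha x * x = one).
  { intro x.
    assert (E := Q_id one x one).
    now rewrite alpha1, !mul1l in E. }
  assert (rip : forall x y : Q, (x * y) * alpha y = x).
  { intros x y.
    destruct (alpha_onto x) as [t <-].
    now rewrite (Q_id t one y), !mul1r. }
  assert (lip := left_inverse_property Q alpha Q_moufang invl rip).
  assert (alphaK := inversion_involutive Q alpha invl rip).
  assert (comm := commutative_of_inversion Q alpha alpha_hom alphaK lip rip).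
  assert (assoc := associative_of_moufang Q alpha Q_moufang alphaK rip comm).
  exact (middle_bol_of_abelian_group Q alpha alpha_hom invl alphaK comm assoc).
Qed.
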